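(* Let $n\ge1$ and let $(\mathcal{G},C)\in OCG_n$ with $C=(v_1,e_1,v_2,\dots,v_j,e_j)$. Denote by $f_C$ the number of flexible edges of $\mathcal{G}$ distinct from $e_1$ (so if $e_1$ is rigid, $f_C$ is the number of flexible edges of $\mathcal{G}$, and if $e_1$ is flexible, $f_C$ is that number minus $1$). Then $$\big|\{\pi\in\mathcal{NC}(2n): (\mathcal{G}_\pi,C_\pi)=(\mathcal{G},C)\}\big|=2^{f_C}.$$ Here $\pi$ ranges over partitions for which $\mathcal{G}_\pi$ is connected, so that $C_\pi$ is defined.
   Context: $\mathcal{NC}(2n)$ is the set of non-crossing partitions of $\{1,\dots,2n\}$. For $\pi\in\mathcal{NC}(2n)$, the undirected graph $\mathcal{G}_\pi$ (loops and multiple edges allowed) has as vertices the blocks of $\pi$, and for each $k=1,\dots,n$ one edge joining the block containing $2k-1$ and the block containing $2k$. Cacti. In a graph with loops and multiple edges allowed, a cycle is a finite sequence $(v_1,e_1,\dots,v_j,e_j)$ of vertices and edges such that $e_i$ connects $v_i$ with $v_{i+1}$ for $i=1,\dots,j$ (with $v_{j+1}=v_1$); repetitions are allowed. A simple cycle is a cycle with pairwise distinct vertices and pairwise distinct edges, considered up to cyclic rotation and reversal (a loop gives one with $j=1$, a pair of parallel edges one with $j=2$). A cactus is a connected graph in which every edge belongs to at most one simple cycle; an edge is rigid if it belongs to a simple cycle and flexible otherwise. An outercycle (orientation) of a cactus $\mathcal{G}$ is a cycle $C$ passing exactly once through every rigid edge and exactly twice through every flexible edge. Outercycles $C=(v_1,e_1,\dots,v_j,e_j)$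 and $C'=(v_1',e_1',\dots,v_j',e_j')$ of $\mathcal{G}$ are considered the same if some automorphism $g$ of $\mathcal{G}$ (acting on vertices and edges) satisfies $g(v_i)=v_i'$, $g(e_i)=e_i'$ for all $i$ (cyclic rotations are not otherwise identified). $OCG_n$ is the set of oriented cacti $(\mathcal{G},C)$ ($\mathcal{G}$ a cactus, $C$ an outercycle) with exactly $n$ edges, taken up to isomorphism; equality $(\mathcal{G}_\pi,C_\pi)=(\mathcal{G},C)$ means that there is a graph isomorphism carrying $C_\pi$ entrywise to $C$. Canonical outercycle $C_\pi$. For $\pi\in\mathcal{NC}(2n)$ with $\mathcal{G}_\pi$ connected ($\mathcal{G}_\pi$ is then a cactus), let $S_\pi$ be the permutation of $\{1,\dots,2n\}$ whose cycles are the blocks of $\pi$ run in increasing order (if $V=\{y_1<\dots<y_r\}$ is a block, $S_\pi(y_i)=y_{i+1}$, with $y_{r+1}=y_1$), and let $\tau=(1\,2)(3\,4)\cdots(2n-1\ 2n)$. Let $x_1=1,x_2,\dots,x_j$ be the orbit of $1$ under $S_\pi\circ\tau$ (in order, $x_{i+1}=S_\pi(\tau(x_i))$). Let $v_i$ be the block of $\pi$ containing $x_i$ and $e_i$ the edge of $\mathcal{G}_\pi$ corresponding to the pair $\{x_i,\tau(x_i)\}$. Then $C_\pi=(v_1,e_1,v_2,e_2,\dots,v_j,e_j)$, which is an outercycle of $\mathcal{G}_\pi$. *)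

(* Defs.v *)
From mathcomp Require Import all_boot.
From mathcomp Require Import boolp.

Set Implicit Arguments.
Unset Strict Implicit.
Unset Printing Implicit Defensive.

(* Finite undirected graphs with loops and multiple edges: an edge is incident
   to a set of one (loop) or two vertices. *)
Record mgraph := MGraph {
  vertex : finType;
  edge : finType;
  ends : edge -> {set vertex};
  ends_card : forall e, 0 < #|ends e| <= 2
}.

Definition connects (G : mgraph) (e : edge G) (u v : vertex G) : bool :=
  ends e == [set u; v].

Definition connected (G : mgraph) : Prop :=
  forall u v : vertex G, connect (fun x y => [exists e, connects e x y]) u v.

(* The sequence (v_1, e_1, ..., v_j, e_j) is encoded as the list of pairs
   [:: (v_1, e_1); ...; (v_j, e_j)]. *)
Definition walk (G : mgraph) := seq (vertex G * edge G).

Definition is_cycle (G : mgraph) (c : walk G) : bool :=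
  path.cycle (fun x y => connects x.2 x.1 y.1) c.

Definition simple_cycle (G : mgraph) (c : walk G) : bool :=
  [&& is_cycle c, uniq (unzip1 c) & uniq (unzip2 c)].

(* (v_1, e_j, v_j, e_{j-1}, ..., v_2, e_1) *)
Definition reversal (G : mgraph) (c : walk G) : walk G :=
  zip (rev (rot 1 (unzip1 c))) (rev (unzip2 c)).

Definition same_cycle (G : mgraph) (c c' : walk G) : Prop :=
  exists k, c' = rot k c \/ c' = rot k (reversal c).

Definition cactus (G : mgraph) : Prop :=
  connected G /\
  forall (e : edge G) (c c' : walk G),
    simple_cycle c -> simple_cycle c' ->
    e \in unzip2 c -> e \in unzip2 c' -> same_cycle c c'.

Definition rigid (G : mgraph) (e : edge G) : Prop :=
  exists2 c : walk G, simple_cycle c & e \in unzip2 c.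

Definition flexible (G : mgraph) (e : edge G) : Prop := ~ rigid e.

Definition outercycle (G : mgraph) (C : walk G) : Prop :=
  [/\ is_cycle C,
      forall e, rigid e -> count_mem e (unzip2 C) = 1
    & forall e, flexible e -> count_mem e (unzip2 C) = 2].

Definition OCG (n : nat) (G : mgraph) (C : walk G) : Prop :=
  [/\ cactus G, outercycle C & #|edge G| = n].

Definition oriented_iso (G : mgraph) (C : walk G) (G' : mgraph) (C' : walk G')
    : Prop :=
  exists (f : vertex G -> vertex G') (g : edge G -> edge G'),
    [/\ bijective f, bijective g,
        forall e, ends (g e) = f @: ends e
      & C' = [seq (f x.1, g x.2) | x <- C]].

(* The number of flexible edges distinct from e_1. *)
Definition flexcount (G : mgraph) (C : walk G) : nat :=
  #|[set e : edge G | `[< flexible e >] & ohead (unzip2 C) != Some e]|.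

Definition noncrossing m (P : {set {set 'I_m}}) : bool :=
  [forall B1 in P, forall B2 in P,
   forall a in B1, forall b in B2, forall c in B1, forall d in B2,
     [&& a < b, b < c & c < d] ==> (B1 == B2)].

(* Non-crossing partitions of {1, ..., m}; x : 'I_m stands for x.+1. *)
Definition NC m :=
  {P : {set {set 'I_m}} | partition P [set: 'I_m] && noncrossing P}.

Section GraphOfPartition.
Variables (n : nat) (pi : NC n.*2).

Definition blockT := {B : {set 'I_n.*2} | B \in val pi}.

Lemma pblock_in (x : 'I_n.*2) : pblock (val pi) x \in val pi.
Proof.
have /andP[/and3P[/eqP cov _ _] _] := valP pi.
by rewrite pblock_mem // cov inE.
Qed.

Definition block_of (x : 'I_n.*2) : blockT :=
  exist (fun B => is_true (B \in val pi)) (pblock (val pi) x) (pblock_in x).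

Lemma left_proof (k : 'I_n) : k.*2 < n.*2.
Proof. by rewrite ltn_double. Qed.

Lemma right_proof (k : 'I_n) : k.*2.+1 < n.*2.
Proof. by rewrite ltn_Sdouble. Qed.

(* With 0-based indices, edge k joins the blocks of 2k and 2k+1. *)
Definition pends (k : 'I_n) : {set blockT} :=
  [set block_of (Ordinal (left_proof k)); block_of (Ordinal (right_proof k))].

Lemma pends_card (k : 'I_n) : 0 < #|pends k| <= 2.
Proof. by rewrite cards2; case: (_ != _). Qed.

Definition pgraph : mgraph := MGraph pends_card.

(* [enum] lists a block in increasing order and [next] is its cyclic
   successor function. *)
Definition Sperm (x : 'I_n.*2) : 'I_n.*2 := next (enum (pblock (val pi) x)) x.

Lemma tau_proof (x : 'I_n.*2) : (if odd x then x.-1 else x.+1) < n.*2.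
Proof.
case: ifP => ox; first exact: leq_ltn_trans (leq_pred x) (ltn_ord x).
by rewrite -(even_halfK (negbT ox)) ltn_Sdouble ltn_half_double.
Qed.

Definition tau (x : 'I_n.*2) : 'I_n.*2 := Ordinal (tau_proof x).

Lemma pair_proof (x : 'I_n.*2) : x./2 < n.
Proof. by rewrite ltn_half_double. Qed.

Definition pair_of (x : 'I_n.*2) : 'I_n := Ordinal (pair_proof x).

Lemma first_proof : 0 < n -> 0 < n.*2.
Proof. by rewrite double_gt0. Qed.

Definition canonical_outercycle (n_gt0 : 0 < n) : walk pgraph :=
  [seq (block_of x, pair_of x)
     | x <- orbit (Sperm \o tau) (Ordinal (first_proof n_gt0))].

End GraphOfPartition.

(* Main.v *)
Require Import Defs.
From mathcomp Require Import all_boot.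
From mathcomp Require Import boolp.
From mathcomp Require Import zify.

Set Implicit Arguments.
Unset Strict Implicit.
Unset Printing Implicit Defensive.

(** The numbers 0, ..., 2n-1 are the darts (half-edges) of the graph of a
    partition: the edge [k] consists of the darts [2k] and [2k+1]. Its canonical
    outercycle passes through the edge [k] forward when it leaves a vertex along
    the dart [2k], and backward when it leaves along [2k+1]. The partitions with
    a given outercycle [C] correspond to the choices, for every edge, of the one
    passage of [C] through it that is forward. A rigid edge has one passage and
    a flexible edge has two, but the very first passage of [C] is forward
    because the canonical outercycle starts at the dart 0. Hence there are two
    possibilities for each flexible edge other than the first edge, and
    [2 ^ flexcount C] partitions.

    The forward passages determine the partition. Consider the 2n+1 cuts
    between consecutive darts (the two ends of the line included), and call two
    of them alike if the darts between them form a union of blocks. As [pi] is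
    non-crossing, the cut after a dart [y] is alike to the cut before its
    successor in the block ([alike_Sperm]); as the graph is connected, distinct
    even cuts are never alike, except for the two ends of the line
    ([even_alike]). It follows that the canonical outercycle meets the even
    darts in the order 0, 2, 4, ... ([forward_dart]). So if the k-th forward
    passage, counted from 0, leads from the vertex [v] to the vertex [w], then
    [2k] belongs to the block of [v] and [2k+1] to that of [w]
    ([labelling_determined]).

    Conversely, every choice is realised by the partition just described. It is
    non-crossing because two vertices of a cactus are separated by a cut that
    [C] crosses at most twice ([cactus_cut]), so that the visits of [C] to these
    vertices do not interleave ([tour_uncrossed]). Its canonical outercycle is
    [C] because the successor of [y] is the only dart of the block whose cut is
    alike to the one after [y] ([Sperm_unique]), and the darts to be skipped
    around a backward passage are those beyond a bridge ([alike_backward]). *)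

(** * Cuts in cacti *)

Section Graphs.
Variable G : mgraph.
Implicit Types (e f : edge G) (x y u v : vertex G) (F : {set edge G}).

Definition adjacent_off F : rel (vertex G) :=
  fun x y => [exists f, connects f x y && (f \notin F)].

Definition component_off F u : pred (vertex G) :=
  fun x => connect (adjacent_off F) u x.

Lemma connectsC e x y : connects e x y = connects e y x.
Proof. by rewrite /connects setUC. Qed.

Lemma connects_ends e x y : connects e x y -> (x \in ends e) * (y \in ends e).
Proof. by move=> /eqP ->; rewrite !inE !eqxx orbT. Qed.

Lemma connects_inj e x y u v : connects e x y -> connects e u v ->
  (x = u /\ y = v) \/ (x = v /\ y = u).
Proof.
move=> /eqP E1 /eqP E2.
have [xu|nxu] := eqVneq x u.
  left; split=> //; apply/eqP.
  have: v \in [set x; y] by rewrite -E1 E2 !inE eqxx orbT.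
  have: y \in [set u; v] by rewrite -E2 E1 !inE eqxx orbT.
  by rewrite !inE xu => /orP[/eqP->|//]; rewrite orbb eq_sym.
right.
have: x \in [set u; v] by rewrite -E2 E1 !inE eqxx.
have: u \in [set x; y] by rewrite -E1 E2 !inE eqxx.
by rewrite !inE (negbTE nxu) eq_sym (negbTE nxu) /= => /eqP -> /eqP ->.
Qed.

Lemma component_off_step F u f x y :
  connects f x y -> f \notin F -> component_off F u x = component_off F u y.
Proof.
move=> fxy fF; apply/idP/idP => /connect_trans; apply; apply: connect1;
  apply/existsP; exists f; by rewrite fF ?fxy // connectsC fxy.
Qed.

Lemma adjacent_off_sym F : connect_sym (adjacent_off F).
Proof.
apply: sym_connect_sym => x y; apply: eq_existsb => f.
by rewrite connectsC.
Qed.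

Lemma cut_constant (X : pred (vertex G)) : connected G ->
  (forall e x y, connects e x y -> X x = X y) -> forall x y, X x = X y.
Proof.
move=> conG cl x y.
apply: (closed_connect (a := X)) (conG x y) => u v /existsP[e].
exact: cl.
Qed.

(** Any edges may be picked along the path: when its vertices are distinct, so
    are its edges, because the first one has an end that no later one touches.
    The third clause lets the walk be spliced into a cycle. *)
Lemma walk_of_path F x p : path (adjacent_off F) x p ->
  exists w : walk G,
    [/\ unzip1 w = belast x p,
        forall f, f \in unzip2 w -> (f \notin F) /\ ends f \subset x :: p,
        forall u g g', connects g u x ->
          path (fun a b => connects a.2 a.1 b.1) (u, g) (rcons w (last x p, g'))
      & uniq (x :: p) -> uniq (unzip2 w)].
Proof.
elim: p x => [|y p IH] x /=.
  by move=> _; exists [::]; split=> // u g g' cg; rewrite /= cg.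
move=> /andP[/existsP[h /andP[hxy hF]] /IH[w [w1 wF wp wu]]].
exists ((x, h) :: w); split=> /=.
- by rewrite w1.
- move=> f; rewrite inE => /predU1P[->|/wF[fF fs]]; split=> //.
    rewrite (eqP hxy); apply/subsetP => z; rewrite !inE.
    by case/orP=> ->; rewrite ?orbT.
  apply: subset_trans fs _; apply/subsetP => z; rewrite !inE => ->.
  by rewrite orbT.
- by move=> u g g' cg; rewrite cg wp.
- move=> /andP[xp up]; rewrite wu // andbT; apply/negP => /wF[_ /subsetP sub].
  by move: xp; rewrite sub // (connects_ends hxy).
Qed.

(** Closing up a path that avoids [e] by [e] itself. *)
Lemma simple_cycle_through F e a b : e \in F -> connects e a b ->
  component_off F b a ->
  exists c : walk G, [/\ simple_cycle c, e \in unzip2 c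
    & forall f, f \in unzip2 c -> f \in F -> f = e].
Proof.
move=> eF eab /connectP[p0 pp0 ap0].
move: ap0; case/shortenP: pp0 => p pp up _ ap {p0}.
have [w [w1 wF wp wu]] := walk_of_path pp.
exists ((a, e) :: w); split=> /=.
- apply/and3P; split.
  + by rewrite /is_cycle /= ap wp // -ap.
  + by rewrite /= w1 ap -rcons_uniq -lastI.
  + rewrite /= wu // andbT; apply/negP => /wF[]; by rewrite eF.
- by rewrite mem_head.
- by move=> f; rewrite inE => /predU1P[//|/wF[/negP]].
Qed.

(** A flexible edge is a bridge: the cut consists of what is reachable from
    [u] without [e]; reaching [w] would close up to a simple cycle. *)
Lemma flexible_cut e u w : flexible e -> connects e u w ->
  exists X : pred (vertex G),
    forall f x y, connects f x y -> X x (+) X y = (f == e).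
Proof.
move=> flex euw; pose X := component_off [set e] u; exists X.
have Xu : X u by exact: connect0.
have Xw : ~~ X w.
  apply/negP => Xw; apply: flex.
  have ewu : connects e w u by rewrite connectsC.
  have [c [sc ec _]] := simple_cycle_through (set11 e) ewu Xw.
  by exists c.
move=> f x y fxy; case: eqP => [fe|/eqP nfe]; last first.
  by rewrite /X (component_off_step _ fxy) ?inE // addbb.
rewrite fe in fxy.
by have [[-> ->]|[-> ->]] := connects_inj fxy euw; rewrite Xu (negbTE Xw).
Qed.

Lemma simple_cycle_other_edge e a b (c : walk G) :
  simple_cycle c -> e \in unzip2 c -> connects e a b -> a != b ->
  exists f, [/\ f \in unzip2 c, f != e & a \in ends f].
Proof.
move=> /and3P[cc _ uc] /mapP[[v e'] /= vec ee' eab nab].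
subst e'; have [i s' rs] := rot_to vec.
have memc f : (f \in unzip2 c) = (f \in e :: unzip2 s').
  by rewrite -(mem_rot i) /unzip2 -map_rot rs.
have : uniq (unzip2 (rot i c)) by rewrite /unzip2 map_rot rot_uniq.
move: cc; rewrite /is_cycle -(rot_cycle i) rs /= rcons_path.
case: s' rs memc => [|[v1 f1] s] rs memc /=.
  move=> evv _; case: (connects_inj eab evv) => -[av bv];
    by rewrite av bv eqxx in nab.
move=> /andP[/andP[evv1 ps] lastv] /andP[enf _].
case: (connects_inj eab evv1) => -[av _].
(* [e] leaves [a]: the other edge is the one by which the cycle returns. *)
- exists (last (v1, f1) s).2.
  have ls : (last (v1, f1) s).2 \in f1 :: unzip2 s.
    by rewrite -[_ :: _]/(unzip2 ((v1, f1) :: s)) map_f // mem_last.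
  split; first by rewrite memc inE ls orbT.
  + by apply: contraNneq enf => <-.
  + by rewrite av (connects_ends lastv).
- exists f1; split.
  + by rewrite memc !inE eqxx orbT.
  + by apply: contraNneq enf => <-; rewrite mem_head.
  + rewrite av; move: ps lastv; case: s {rs memc enf} => [|[v2 f2] s] /=.
      by move=> _ /connects_ends[-> _].
    by move=> /andP[/connects_ends[-> _]].
Qed.

Lemma same_cycle_edges (c c' : walk G) :
  same_cycle c c' -> unzip2 c' =i unzip2 c.
Proof.
move=> [k [->|->]] f; rewrite /unzip2 map_rot mem_rot //.
by rewrite -/(unzip2 _) unzip2_zip ?mem_rev // !size_rev size_rot !size_map.
Qed.

(** Any two vertices of a cactus are separated by a cut that an outercycle
    crosses at most twice, namely the component of [a] once the following edges
    are removed: the first edge [e] of a path from [a] to [b] with distinct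
    vertices and, if [e] is rigid, the other edge at [a] of the cycle through
    [e]. If [b] were still reachable from [a], the rest of the path (which
    avoids [a], hence the removed edges) would close up to a simple cycle
    through [e] that misses the second edge. *)
Lemma cactus_cut (C : walk G) a b : cactus G -> outercycle C -> a != b ->
  exists (X : pred (vertex G)) F,
    [/\ X a, ~~ X b, forall f x y, connects f x y -> f \notin F -> X x = X y
      & count (fun f => f \in F) (unzip2 C) <= 2].
Proof.
move=> [conG uniqZ] [_ rig flex] nab.
have /connectP[p0 pp0 bp0] := conG a b.
move: bp0; case/shortenP: pp0 => -[|a' p] /=.
  by move=> _ _ _ ab; rewrite ab eqxx in nab.
move=> /andP[/existsP[e eaa'] pp] /andP[ap _] _ bp.
have naa' : a != a' by apply: contraNneq ap => <-; rewrite mem_head.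
suff [F [eF F_at_a noZ cF]] : exists F, [/\ e \in F,
    forall f, f \in F -> a \in ends f,
    ~ (exists c : walk G, [/\ simple_cycle c, e \in unzip2 c
        & forall f, f \in unzip2 c -> f \in F -> f = e])
  & count (fun f => f \in F) (unzip2 C) <= 2].
  exists (component_off F a), F; split=> //; first exact: connect0.
  - apply/negP => Xb; apply: noZ.
    apply: (simple_cycle_through (a := a) (b := a') eF eaa').
    apply: connect_trans (_ : connect _ b a); last by rewrite adjacent_off_sym.
    apply/connectP; exists p => //.
    elim: p a' {eaa' naa' bp} ap pp => //= y p IH x.
    rewrite !inE !negb_or => /and3P[nx ny np] /andP[/existsP[f fxy] pp].
    rewrite IH ?inE ?negb_or ?ny // andbT; apply/existsP; exists f.
    rewrite fxy /=; apply/negP => /F_at_a.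
    by rewrite (eqP fxy) !inE (negbTE nx) (negbTE ny).
  - by move=> f x y; exact: component_off_step.
case: (EM (rigid e)) => [re|fe]; last first.
  exists [set e]; split.
  - by rewrite inE.
  - by move=> f /set1P->; rewrite (connects_ends eaa').
  - by case=> c [sc ec _]; apply: fe; exists c.
  - by rewrite (eq_count (a2 := pred1 e)) ?flex // => f; rewrite inE.
have [Z sZ eZ] := re.
have [f1 [f1Z nf1 af1]] := simple_cycle_other_edge sZ eZ eaa' naa'.
exists [set e; f1]; split.
- by rewrite !inE eqxx.
- by move=> f /set2P[]-> //; rewrite (connects_ends eaa').
- case=> c [sc ec ce].
  have f1c : f1 \in unzip2 c.
    by rewrite (same_cycle_edges (uniqZ e Z c sZ sc eZ ec)).
  by move: nf1; rewrite (ce f1 f1c) ?eqxx // !inE eqxx orbT.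
- rewrite (eq_count (a2 := predU (pred1 e) (pred1 f1))) => [|f]; last first.
    by rewrite !inE.
  have rf1 : rigid f1 by exists Z.
  have := count_predUI (pred1 e) (pred1 f1) (unzip2 C).
  by rewrite rig // rig // -[X in _ <= X]/(1 + 1) => <-; rewrite leq_addr.
Qed.

End Graphs.

(** * Cuts of the line and successors inside a block *)

Lemma next_enumP m (B : {set 'I_m}) (y : 'I_m) : y \in B ->
  next (enum B) y \in B /\
  ((y < next (enum B) y /\
      forall z, z \in B -> z <= y \/ next (enum B) y <= z)
   \/ (next (enum B) y <= y /\
      forall z, z \in B -> next (enum B) y <= z <= y)).
Proof.
move=> yB; split; first by rewrite -mem_enum mem_next mem_enum.
rewrite next_nth mem_enum yB.
have memB z : (z \in enum B) = (z \in B) by rewrite mem_enum.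
have : sorted (fun u v : 'I_m => u < v) (enum B).
  rewrite /enum_mem sorted_filter //; first by move=> ? ? ?; exact: ltn_trans.
  have := iota_ltn_sorted 0 m; rewrite -val_enum_ord sorted_map.
  by rewrite enumT.
case: (enum B) memB => [|x s] memB.
  by move: yB; rewrite -memB.
move=> srt; set i := index y (x :: s).
have ltr : transitive (fun u v : 'I_m => u < v).
  by move=> ? ? ?; exact: ltn_trans.
have lt_nth j k : j < size (x :: s) -> k < size (x :: s) -> j < k ->
    nth x (x :: s) j < nth x (x :: s) k.
  by move=> js ks jk; apply: (sorted_ltn_nth ltr).
have yi : nth x (x :: s) i = y :> nat by rewrite nth_index ?memB.
have isz : i < size (x :: s) by rewrite index_mem memB.
have [is1|is1] := ltnP i (size s); [left|right].
  rewrite -[nth x s i]/(nth x (x :: s) i.+1).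
  split; first by rewrite -[X in X < _]yi; apply: lt_nth.
  move=> z; rewrite -memB => zs.
  have zsz : index z (x :: s) < size (x :: s) by rewrite index_mem.
  have zi : nth x (x :: s) (index z (x :: s)) = z :> nat by rewrite nth_index.
  have [lt|ge] := ltnP i (index z (x :: s)); [right|left].
    move: lt; rewrite leq_eqVlt => /predU1P[->|lt]; first by rewrite zi.
    by apply: ltnW; rewrite -[X in _ < X]zi; apply: lt_nth.
  move: ge; rewrite leq_eqVlt => /predU1P[e|lt]; first by rewrite -yi -e zi.
  by apply: ltnW; rewrite -[X in X < _]zi -[X in _ < X]yi; apply: lt_nth.
rewrite nth_default //.
have first z : z \in B -> x <= z <= y.
  rewrite -memB => zs.
  have zsz : index z (x :: s) < size (x :: s) by rewrite index_mem.
  have zi : nth x (x :: s) (index z (x :: s)) = z :> nat by rewrite nth_index.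
  apply/andP; split.
    have [e|gt] := posnP (index z (x :: s)); first by rewrite -zi e.
    by apply: ltnW; rewrite -[X in _ < X]zi; apply: (lt_nth 0).
  have: index z (x :: s) <= i by apply: leq_trans is1.
  rewrite leq_eqVlt => /predU1P[e|lt]; first by rewrite -yi -e zi.
  by apply: ltnW; rewrite -[X in X < _]zi -[X in _ < X]yi; apply: lt_nth.
by split; first by have /andP[] := first y yB.
Qed.

Section Partition.
Variables (n : nat) (pi : NC n.*2).
Implicit Types (x y z w : 'I_n.*2) (c d : nat).
Local Notation blk := (pblock (val pi)).

Lemma mem_blk x : x \in blk x.
Proof.
have /andP[/and3P[/eqP cov _ _] _] := valP pi.
by rewrite mem_pblock cov inE.
Qed.

Lemma blk_eq x y : x \in blk y -> blk x = blk y.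
Proof. by have /andP[/and3P[_ tr _] _] := valP pi; exact: same_pblock. Qed.

Lemma blk_uncrossed (a b c d : 'I_n.*2) : a < b -> b < c -> c < d ->
  blk a = blk c -> blk b = blk d -> blk a = blk b.
Proof.
move=> ab bc cd eac ebd; have /andP[_ /'forall_implyP nc] := valP pi.
have /'forall_implyP/(_ _ (pblock_in pi b)) := nc _ (pblock_in pi a).
move=> /'forall_implyP/(_ a (mem_blk a)) /'forall_implyP/(_ b (mem_blk b)).
have cA : c \in blk a by rewrite eac mem_blk.
have dB : d \in blk b by rewrite ebd mem_blk.
move=> /'forall_implyP/(_ c cA) /'forall_implyP/(_ d dB).
by rewrite ab bc cd => /eqP.
Qed.

(** A natural number [c] stands for the cut of the line before the dart [c].
    Two cuts are alike when the darts between them form a union of blocks,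
    i.e. when they can be joined by an arc that meets no block. *)
Definition alike c d : Prop :=
  forall z w, blk z = blk w ->
    (z < c) (+) (z < d) = (w < c) (+) (w < d).

Lemma alike_refl c : alike c c.
Proof. by move=> z w _; rewrite !addbb. Qed.

Lemma alike_sym c d : alike c d -> alike d c.
Proof. by move=> cd z w /cd; rewrite addbC [in X in _ = X]addbC. Qed.

Lemma alike_trans d c (e : nat) : alike c d -> alike d e -> alike c e.
Proof.
move=> cd de z w zw; have := cd z w zw; have := de z w zw.
by case: (z < c) (z < d) (z < e) (w < c) (w < d) (w < e) => [] [] [] [] [] [].
Qed.

Lemma alike_ends c : n.*2 <= c -> alike c 0.
Proof.
by move=> cn z w _; rewrite !ltn0 !(leq_trans (ltn_ord _) cn).
Qed.

(** This is where planarity enters: the chord from a dart to its successor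
    in the block is crossed by no other block. *)
Lemma alike_Sperm y : alike y.+1 (Sperm pi y).
Proof.
have [] := next_enumP (mem_blk y); rewrite -/(Sperm pi y).
move: (Sperm pi y) => s /blk_eq sy order z w zw.
wlog: z w zw / (w < y.+1) (+) (w < s) = false => [wlg|ws].
  case Ew: ((w < y.+1) (+) (w < s)); last first.
    by rewrite (wlg z w).
  case Ez: ((z < y.+1) (+) (z < s)) => //.
  by rewrite -Ez -Ew; apply/esym/wlg.
(* [z] lies between the two cuts and [w] does not. *)
rewrite ws; apply/negbTE/negP => zs.
have [zy|nzy] := eqVneq (blk z) (blk y).
  have zB : z \in blk y by rewrite -zy mem_blk.
  have wB : w \in blk y by rewrite -zy zw mem_blk.
  case: order => -[ys order]; move: (order z zB) (order w wB); lia.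
have nwy : w != y by apply: contra nzy => /eqP <-; rewrite zw.
have nws : w != s by apply: contra nzy => /eqP ws'; rewrite zw ws' sy.
have nzs : z != s by apply: contra nzy => /eqP ->; rewrite sy.
have nzy' : z != y by apply: contra nzy => /eqP ->.
rewrite -!val_eqE /= in nwy nws nzs nzy'.
have nyz : blk y != blk z by rewrite eq_sym.
case: order => -[ys _].
  have [wy|yw] := ltnP w y.
    have : blk w = blk y by apply: (@blk_uncrossed w y z s) => //; lia.
    by move/eqP; rewrite -zw (negbTE nzy).
  have : blk y = blk z by apply: (@blk_uncrossed y z s w) => //; lia.
  by move/eqP; rewrite (negbTE nyz).
have [wy|yw] := ltnP w y.
  have : blk w = blk s by apply: (@blk_uncrossed w s z y) => //; lia.
  by move/eqP; rewrite -zw sy (negbTE nzy).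
have : blk s = blk z by apply: (@blk_uncrossed s z y w) => //; lia.
by move/eqP; rewrite sy (negbTE nyz).
Qed.

Lemma blk_Sperm y : blk (Sperm pi y) = blk y.
Proof. by have [/blk_eq] := next_enumP (mem_blk y). Qed.

(** The arc condition characterises the successor, which spares any
    discussion of the cyclic order when a successor has to be identified. *)
Lemma Sperm_unique x y : blk x = blk y -> alike y.+1 x -> Sperm pi y = x.
Proof.
move=> xy yx; apply/val_inj => /=.
have sx := alike_trans (alike_sym (alike_Sperm y)) yx.
have := sx (Sperm pi y) x; rewrite blk_Sperm xy => /(_ erefl).
by rewrite !ltnn /= addbF; case: ltngtP.
Qed.

Lemma Sperm_inj : injective (Sperm pi).
Proof.
move=> x y xy; have E : blk x = blk y by rewrite -blk_Sperm xy blk_Sperm.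
apply: (can_inj (prev_next (enum_uniq (blk x)))).
by rewrite -/(Sperm pi x) xy /Sperm E.
Qed.

Lemma val_tau x : tau x = (if odd x then x.-1 else x.+1) :> nat.
Proof. by []. Qed.

Lemma tauK : involutive (@tau n).
Proof. by move=> x; apply/val_inj => /=; do 2!case: ifP; lia. Qed.

Lemma step_inj : injective (Sperm pi \o @tau n).
Proof. exact: inj_comp Sperm_inj (can_inj tauK). Qed.

Lemma block_ofP (B : blockT pi) : exists x, B = block_of pi x.
Proof.
case: B => B BP; have /andP[/and3P[_ tr n0] _] := valP pi.
have /set0Pn[x xB] : B != set0 by apply: contraNneq n0 => <-.
by exists x; apply/val_inj; rewrite /= (def_pblock tr BP xB).
Qed.

Lemma block_of_eq x y : (block_of pi x == block_of pi y) = (blk x == blk y).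
Proof. by []. Qed.

(** A pair [{2k, 2k+1}] is never split by an even cut, so the darts between
    two alike even cuts are a union of components. *)
Lemma even_alike c d : connected (pgraph pi) -> alike c d ->
  ~~ odd c -> ~~ odd d -> c < d -> c < n.*2 -> c = 0 /\ n.*2 <= d.
Proof.
move=> conn cd oc od ltcd cn.
pose between z := (z < c) (+) (z < d).
pose X (B : vertex (pgraph pi)) := [exists z in val B, between z].
have XE z : X (block_of pi z) = between z.
  apply/existsP/idP => [[w /andP[/blk_eq wz bw]]|bz].
    by rewrite /between (cd z w) // wz.
  by exists z; rewrite mem_blk.
have all_between z : between z.
  (* [c] is itself the first dart after the cut [c]. *)
  suff -> : between z = between (Ordinal cn) by rewrite /between ltnn ltcd.
  rewrite -!XE; apply: (cut_constant conn) => k B B' kBB'.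
  pose l := Ordinal (left_proof k); pose r := Ordinal (right_proof k).
  have lr : connects k (block_of pi l) (block_of pi r) by apply/eqP.
  have Xlr : X (block_of pi l) = X (block_of pi r).
    by rewrite !XE /between /=; lia.
  by have [[-> ->]|[-> ->]] := connects_inj kBB' lr; rewrite Xlr.
have n0 : 0 < n.*2 by lia.
have nn : n.*2.-1 < n.*2 by lia.
have := all_between (Ordinal n0); have := all_between (Ordinal nn).
rewrite /between /=; lia.
Qed.

End Partition.

(** * The even darts of the canonical outercycle *)

Definition rank (P : pred nat) i := count P (iota 0 i).

Lemma rankS P i : rank P i.+1 = rank P i + P i.
Proof. by rewrite /rank -addn1 iotaD count_cat /= addn0. Qed.

Lemma rank_le P i j : i <= j -> rank P i <= rank P j.
Proof. by move=> /subnKC <-; rewrite /rank iotaD count_cat leq_addr. Qed.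

Lemma rank_lt (P : pred nat) i j : P i -> i < j -> rank P i < rank P j.
Proof.
by move=> Pi ij; apply: leq_trans (rank_le P ij); rewrite rankS Pi addn1.
Qed.

Lemma ltn_rank (P : pred nat) i j : P i -> (rank P i < rank P j) = (i < j).
Proof.
move=> Pi; apply/idP/idP => [|/(rank_lt Pi) //].
by apply: contraTT; rewrite -!leqNgt => /(rank_le P).
Qed.

Section CanonicalOrbit.
Variables (n : nat) (n_gt0 : 0 < n) (pi : NC n.*2).

Definition dart i := iter i (Sperm pi \o @tau n) (Ordinal (first_proof n_gt0)).

Definition period := order (Sperm pi \o @tau n) (Ordinal (first_proof n_gt0)).

Definition forward i := ~~ odd (dart i).

Lemma dartS i : dart i.+1 = Sperm pi (tau (dart i)).
Proof. by []. Qed.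

Lemma dart_period : dart period = dart 0.
Proof. exact: iter_order (@step_inj _ pi) _. Qed.

Lemma nth_orbit x0 i : i < period ->
  nth x0 (orbit (Sperm pi \o @tau n) (Ordinal (first_proof n_gt0))) i = dart i.
Proof. move=> ip; rewrite (set_nth_default (dart 0)) ?size_orbit //.
by rewrite /orbit nth_traject. Qed.

Lemma dart_inj i j : i < period -> j < period -> dart i = dart j -> i = j.
Proof.
move=> ip jp ij; apply/eqP.
rewrite -(nth_uniq (dart 0) _ _ (orbit_uniq (Sperm pi \o @tau n) (dart 0))).
- by rewrite !nth_orbit // ij.
- by rewrite size_orbit.
- by rewrite size_orbit.
Qed.

Lemma dart_neq0 i : 0 < i -> i < period -> 0 < dart i.
Proof.
move=> i0 ip; rewrite lt0n; apply/negP => /eqP di.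
have d0 : dart i = dart 0 by apply/val_inj.
by rewrite (dart_inj ip (order_gt0 _ _) d0) in i0.
Qed.

Hypothesis conn : connected (pgraph pi).

(** The step at an even dart of the induction for [alike_dart]. *)
Lemma forward_dart_of i : i < period -> alike pi (rank forward i).*2 (dart i) ->
  forward i -> dart i = (rank forward i).*2 :> nat.
Proof.
move=> ip ali ei; have er : ~~ odd (rank forward i).*2 by rewrite odd_double.
have [lt|lt|//] := ltngtP (dart i) (rank forward i).*2.
- have [i0|i0] := posnP i; first by rewrite i0 in lt.
  have [d0 _] := even_alike conn (alike_sym ali) ei er lt (ltn_ord _).
  by have := dart_neq0 i0 ip; rewrite d0.
- have [_] := even_alike conn ali er ei lt (ltn_trans lt (ltn_ord _)).
  by rewrite leqNgt ltn_ord.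
Qed.

(** The walk moves from the cut after the last even dart to the next dart
    without ever crossing a block: odd darts only make it go around an arc.
    By connectedness the next even dart is therefore the one just after that
    cut. *)
Lemma alike_dart i : i <= period -> alike pi (rank forward i).*2 (dart i).
Proof.
elim: i => [|i IH] ip; first exact: alike_refl.
rewrite rankS dartS; have /IH{}IH := ltnW ip.
have := alike_Sperm (pi := pi) (tau (dart i)); rewrite val_tau.
have [fi|] := boolP (forward i).
  have E := forward_dart_of ip IH fi; rewrite (negbTE fi) E => S.
  by rewrite addn1 doubleS.
rewrite /forward negbK => oi; rewrite oi addn0 => S.
apply: alike_trans IH _; move: S.
by rewrite prednK //; case: (nat_of_ord (dart i)) oi.
Qed.

Lemma forward_dart i : i < period -> forward i ->
  dart i = (rank forward i).*2 :> nat.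
Proof. by move=> ip; apply: forward_dart_of (alike_dart (ltnW ip)). Qed.

Lemma rank_period : n <= rank forward period.
Proof.
have p0 : 0 < period by exact: order_gt0.
have r0 : 0 < rank forward period by apply: leq_trans (rank_le _ p0).
rewrite -leq_double.
have := alike_dart (leqnn period); rewrite dart_period => S.
have er : ~~ odd (rank forward period).*2 by rewrite odd_double.
have rp : 0 < (rank forward period).*2 by rewrite double_gt0.
by have [] := even_alike conn (alike_sym S) isT er rp (ltn_ord (dart 0)).
Qed.

Lemma rank_surj (P : pred nat) i k :
  k < rank P i -> exists j, [/\ j < i, P j & rank P j = k].
Proof.
elim: i => // i IH; rewrite rankS; have [kr|rk] := ltnP k (rank P i).
  by have [j [ji Pj rj]] := IH kr; exists j; rewrite ltnW.
case Pi: (P i) => /= kr; exists i; split=> //; lia.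
Qed.

Lemma dart_surj k : k < n ->
  exists i, [/\ i < period, forward i & dart i = k.*2 :> nat].
Proof.
move=> kn; have [i [ip fi <-]] := rank_surj (leq_trans kn rank_period).
by exists i; rewrite forward_dart.
Qed.

End CanonicalOrbit.

(** * Labellings of the darts by a graph *)

Section Labelling.
Variables (n : nat) (n_gt0 : 0 < n) (pi : NC n.*2) (G : mgraph).

(** An isomorphism from the graph of a partition, pulled back to the darts. *)
Definition labelling (C : walk G)
    (l : 'I_n.*2 -> vertex G) (g : 'I_n -> edge G) : Prop :=
  [/\ bijective g, forall v, exists x, l x = v,
      forall x y, (l x == l y) = (pblock (val pi) x == pblock (val pi) y),
      forall k, ends (g k) =
        [set l (Ordinal (left_proof k)); l (Ordinal (right_proof k))]
    & C = [seq (l x, g (pair_of x))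
            | x <- orbit (Sperm pi \o @tau n) (Ordinal (first_proof n_gt0))]].

Lemma oriented_isoP C :
  oriented_iso (canonical_outercycle pi n_gt0) C <->
  exists l g, labelling C l g.
Proof.
split=> [[f [g [bf bg endsg ->]]]|[l [g [bg l_surj l_eq endsg CE]]]].
  exists (fun x => f (block_of pi x)), g; split=> //.
  - move=> v; have [h _ hK] := bf.
    have [x hx] := block_ofP (h v).
    by exists x; rewrite -hx hK.
  - by move=> x y; rewrite (bij_eq bf) block_of_eq.
  - by move=> k; rewrite endsg /= /pends imsetU1 imset_set1.
  - by rewrite -map_comp.
pose x0 := Ordinal (first_proof n_gt0).
pose f (B : blockT pi) := l (odflt x0 [pick x in val B]).
have fE x : f (block_of pi x) = l x.
  rewrite /f; case: pickP => [y /= /blk_eq yx|/(_ x)].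
    by apply/eqP; rewrite l_eq yx.
  by rewrite /= mem_blk.
pose h v := block_of pi (sval (cid (l_surj v))).
exists f, g; split=> //.
- exists h.
    move=> B; have [x ->] := block_ofP B; rewrite fE /h.
    case: cid => y /= /eqP; rewrite l_eq => /eqP yx.
    by apply/eqP; rewrite block_of_eq yx.
  by move=> v; rewrite /h; case: cid => y yv; rewrite fE.
- by move=> k; rewrite endsg /= /pends imsetU1 imset_set1 !fE.
- rewrite CE /canonical_outercycle -map_comp; apply: eq_map => x /=.
  by rewrite fE.
Qed.

Lemma labelling_connected C l g :
  labelling C l g -> connected G -> connected (pgraph pi).
Proof.
move=> [[h _ hK] _ l_eq endsg _] conG B B'.
have [[x ->] [y ->]] := (block_ofP B, block_ofP B').
set R := fun _ _ => _.
pose X v := [exists z, (l z == v) && connect R (block_of pi x) (block_of pi z)].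
have R_lr k : R (block_of pi (Ordinal (left_proof k)))
                (block_of pi (Ordinal (right_proof k))).
  by apply/existsP; exists k; apply/eqP.
have R_rl k : R (block_of pi (Ordinal (right_proof k)))
                (block_of pi (Ordinal (left_proof k))).
  by apply/existsP; exists k; rewrite connectsC; apply/eqP.
have XS e u v : connects e u v -> X u -> X v.
  move=> euv /existsP[z /andP[/eqP lz cz]].
  have : connects e (l (Ordinal (left_proof (h e))))
                    (l (Ordinal (right_proof (h e)))).
    by rewrite /connects -endsg hK.
  move=> /(connects_inj euv)[]-[uE vE]; apply/existsP.
    exists (Ordinal (right_proof (h e))); rewrite vE eqxx /=.
    apply: connect_trans cz _; apply: connect1; have := R_lr (h e).
    by congr (R _ _); apply/eqP; rewrite block_of_eq -l_eq -uE lz.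
  exists (Ordinal (left_proof (h e))); rewrite vE eqxx /=.
  apply: connect_trans cz _; apply: connect1; have := R_rl (h e).
  by congr (R _ _); apply/eqP; rewrite block_of_eq -l_eq -uE lz.
have : X (l y).
  have <- : X (l x) = X (l y).
    apply: (cut_constant conG) => e u v euv; apply/idP/idP; apply: XS.
      exact: euv.
    by rewrite connectsC; exact: euv.
  by apply/existsP; exists x; rewrite eqxx connect0.
move=> /existsP[z /andP[]]; rewrite l_eq -block_of_eq => /eqP <-.
by [].
Qed.

End Labelling.

(** * Outercycles as tours *)

Section Tour.
Variables (G : mgraph) (v0 : vertex G) (e0 : edge G) (C' : walk G).
Let C := (v0, e0) :: C'.

(** The default value [v0] makes [vertex_at] return to the start at time
    [size C]. *)
Definition vertex_at t := nth v0 (unzip1 C) t.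
Definition edge_at i := nth e0 (unzip2 C) i.

Hypotheses (cactusG : cactus G) (outerC : outercycle C).
Implicit Types (e : edge G).

Lemma vertex_at_size : vertex_at (size C) = vertex_at 0.
Proof. by rewrite /vertex_at nth_default // size_map. Qed.

Lemma nth_tour i : i < size C -> nth (v0, e0) C i = (vertex_at i, edge_at i).
Proof.
move=> iC; rewrite /vertex_at /edge_at /unzip1 /unzip2.
by rewrite !(nth_map (v0, e0)) // -surjective_pairing.
Qed.

Lemma tour_step i : i < size C ->
  connects (edge_at i) (vertex_at i) (vertex_at i.+1).
Proof.
move=> iC; have [cyc _ _] := outerC; move: cyc.
rewrite /is_cycle /= => /(pathP (v0, e0))/(_ i).
rewrite size_rcons => /(_ iC).
have -> : nth (v0, e0) ((v0, e0) :: rcons C' (v0, e0)) i = nth (v0, e0) C i.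
  by rewrite -rcons_cons nth_rcons iC.
rewrite nth_tour //= nth_rcons; case: ltngtP => [iC1|iC1|iC1].
- by rewrite -[nth _ C' i]/(nth (v0, e0) C i.+1) nth_tour.
- by move: iC; rewrite /= ltnS leqNgt iC1.
- by have := vertex_at_size; rewrite /= iC1 => ->.
Qed.

Lemma tour_crossing (X : pred (vertex G)) (F : {set edge G}) s t :
  (forall f x y, connects f x y -> f \notin F -> X x = X y) ->
  s <= t -> t <= size C -> X (vertex_at s) != X (vertex_at t) ->
  exists i, [/\ s <= i, i < t & edge_at i \in F].
Proof.
move=> XF; elim: t => [|t IH] st tC.
  by move: st; rewrite leqn0 => /eqP->; rewrite eqxx.
have [->|sneq] := eqVneq s t.+1; first by rewrite eqxx.
have st' : s <= t by rewrite -ltnS ltn_neqAle sneq.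
have [tF|tF] := boolP (edge_at t \in F); first by exists t.
rewrite -(XF _ _ _ (tour_step tC) tF) => /(IH st' (ltnW tC))[i [si it iF]].
by exists i; split=> //; apply: ltnW.
Qed.

Lemma count_tour (a : pred (edge G)) :
  count a (unzip2 C) = #|[set i : 'I_(size C) | a (edge_at i)]|.
Proof.
rewrite -sum1_count (big_nth e0) size_map big_mkord -sum1_card.
by apply: eq_bigl => i; rewrite inE.
Qed.

Lemma count_ge3 (a : pred (edge G)) i j k : i < j -> j < k -> k < size C ->
  a (edge_at i) -> a (edge_at j) -> a (edge_at k) -> 2 < count a (unzip2 C).
Proof.
move=> ij jk kC ai aj ak; have jC := ltn_trans jk kC.
have iC := ltn_trans ij jC.
rewrite count_tour.
pose s := [:: Ordinal iC; Ordinal jC; Ordinal kC].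
have <- : #|s| = 3.
  by apply/card_uniqP; rewrite /= !inE -!val_eqE /= negb_or; lia.
by apply: subset_leq_card; apply/subsetP => x;
  rewrite !inE => /or3P[]/eqP->.
Qed.

(** Each of the three passages between interleaved visits would cross a cut
    that the tour crosses only twice. *)
Lemma tour_uncrossed s1 s2 s3 s4 : s1 < s2 -> s2 < s3 -> s3 < s4 ->
  s4 <= size C -> vertex_at s1 = vertex_at s3 -> vertex_at s2 = vertex_at s4 ->
  vertex_at s1 = vertex_at s2.
Proof.
move=> s12 s23 s34 s4C e13 e24; apply/eqP/negPn/negP => n12.
have [X [F [Xa Xb XF]]] := cactus_cut cactusG outerC n12.
have s3C := leq_trans (ltnW s34) s4C; have s2C := leq_trans (ltnW s23) s3C.
have [|i [si is2 iF]] := tour_crossing XF (ltnW s12) s2C.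
  by rewrite Xa (negbTE Xb).
have [|j [sj js3 jF]] := tour_crossing XF (ltnW s23) s3C.
  by rewrite -e13 Xa (negbTE Xb).
have [|k [sk ks4 kF]] := tour_crossing XF (ltnW s34) s4C.
  by rewrite -e13 -e24 Xa (negbTE Xb).
rewrite leqNgt (@count_ge3 (fun f => f \in F) i j k) //; lia.
Qed.

Lemma count_edge e : 0 < count_mem e (unzip2 C) <= 2.
Proof.
have [_ rig flex] := outerC; case: (EM (rigid e)) => [/rig->|/flex->] //.
Qed.

Lemma edge_atP e : exists2 i, i < size C & edge_at i = e.
Proof.
have /andP[+ _] := count_edge e; rewrite -has_count has_pred1 => eC.
exists (index e (unzip2 C)); last by rewrite /edge_at nth_index.
by rewrite -[X in _ < X](size_map (@snd _ _)) index_mem.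
Qed.

(** The visited vertices are closed under adjacency, as all edges are passed. *)
Lemma tour_visits v : exists2 i, i < size C &
  v = vertex_at i \/ v = vertex_at i.+1.
Proof.
pose X u := `[< exists2 i, i < size C &
                  u = vertex_at i \/ u = vertex_at i.+1 >].
apply/asboolP; rewrite -[asbool _]/(X v).
have -> : X v = X v0; last by apply/asboolP; exists 0 => //; left.
apply: (cut_constant cactusG.1) => e x y exy.
have [i iC ie] := edge_atP e.
have := connects_inj exy; rewrite -ie => /(_ _ _ (tour_step iC)) E.
have -> : X x.
  by apply/asboolP; exists i => //; case: E => -[-> _]; [left|right].
by apply/esym/asboolP; exists i => //; case: E => -[_ ->]; [right|left].
Qed.

Lemma edge_at_thrice i j k : i < size C -> j < size C -> k < size C ->
  edge_at i = edge_at j -> edge_at i = edge_at k -> i != j -> i != k -> j = k.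
Proof.
move=> iC jC kC ij ik nij nik; apply/eqP/negPn/negP => njk.
have /andP[_] := count_edge (edge_at i); apply/negP; rewrite -ltnNge count_tour.
pose s := [:: Ordinal iC; Ordinal jC; Ordinal kC].
have <- : #|s| = 3.
  by apply/card_uniqP; rewrite /= !inE -!val_eqE /= negb_or; lia.
apply: subset_leq_card; apply/subsetP => x.
by rewrite !inE => /or3P[]/eqP-> /=; rewrite -?ij -?ik.
Qed.

Lemma twice_flexible i j : i < size C -> j < size C ->
  edge_at i = edge_at j -> i != j -> flexible (edge_at i).
Proof.
move=> iC jC ij nij; have [_ rig _] := outerC; move=> /rig.
rewrite count_tour => /eqP/cards1P[x ox].
have: Ordinal iC \in [set x] by rewrite -ox inE /=.
have: Ordinal jC \in [set x] by rewrite -ox inE /= ij.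
rewrite !inE => /eqP <- /eqP[] /eqP; exact/negP.
Qed.

(** The stretch of the tour between the two passages of a flexible edge
    explores exactly what lies beyond this edge. *)
Lemma flexible_tour i j : i < size C -> j < size C ->
  edge_at i = edge_at j -> i != j ->
  exists X : pred (vertex G), forall t, t <= size C ->
    X (vertex_at t) = X v0 (+) (i < t) (+) (j < t).
Proof.
move=> iC jC ij nij.
have [X XE] := flexible_cut (twice_flexible iC jC ij nij) (tour_step iC).
exists X; elim=> [|t IH] tC; first by rewrite !ltn0 !addbF.
rewrite -[LHS](addKb (X (vertex_at t))) (XE _ _ _ (tour_step tC)).
rewrite IH; last exact: ltnW.
rewrite !ltnS -!addbA; congr addb.
have -> : (edge_at t == edge_at i) = (t == i) || (t == j).
  apply/eqP/orP => [ti|[]/eqP->] //.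
  by case: (eqVneq t i) => [|nti]; [left|right; apply/eqP/(@edge_at_thrice i)];
    rewrite // eq_sym.
by rewrite (eq_sym t) (eq_sym t); case: (ltngtP i t) nij => [||->];
  case: (ltngtP j t) => //= ->; rewrite ?eqxx.
Qed.

(** A flexible edge is passed once in each direction: the first passage enters
    the far side, which has to be left again. *)
Lemma flexible_opposite i j : i < size C -> j < size C ->
  edge_at i = edge_at j -> i != j -> vertex_at i = vertex_at j.+1.
Proof.
move=> iC jC ij nij; have [X XE] := flexible_tour iC jC ij nij.
have := connects_inj (tour_step iC); rewrite ij => /(_ _ _ (tour_step jC)).
case=> -[] // vij _; have := congr1 X vij; rewrite !XE ?(ltnW iC) ?(ltnW jC) //.
by rewrite !ltnn; case: (ltngtP i j) nij => //; case: (X v0).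
Qed.

End Tour.

(** * The partition of a choice of forward passages *)

Section Realisation.
Variables (n : nat) (G : mgraph) (v0 : vertex G) (e0 : edge G) (C' : walk G).
Let C := (v0, e0) :: C'.
Hypothesis ocg : OCG n C.
Local Notation vertex_at := (vertex_at v0 e0 C').
Local Notation edge_at := (edge_at v0 e0 C').

Let cactusG : cactus G. Proof. by case: ocg. Qed.
Let outerC : outercycle C. Proof. by case: ocg. Qed.
Let cardE : #|edge G| = n. Proof. by case: ocg. Qed.

(** [pos e] is the passage of the tour through [e] that is declared forward. *)
Variable pos : edge G -> nat.
Hypothesis pos_lt : forall e, pos e < size C.
Hypothesis edge_pos : forall e, edge_at (pos e) = e.

Definition chosen : pred nat := fun i => pos (edge_at i) == i.

Lemma chosen_pos e : chosen (pos e).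
Proof. by rewrite /chosen edge_pos. Qed.

Lemma pos_inj : injective pos.
Proof. by move=> e f ef; rewrite -(edge_pos e) ef edge_pos. Qed.

Lemma rank_chosen_size : rank chosen (size C) = n.
Proof.
rewrite /rank -size_filter -[RHS]cardE cardT -(size_map pos).
apply/perm_size/uniq_perm.
- exact/filter_uniq/iota_uniq.
- by rewrite map_inj_uniq ?enum_uniq //; exact: pos_inj.
move=> i; rewrite mem_filter mem_iota add0n /=.
apply/andP/mapP => [[/eqP pi _]|[e _ ->]].
  by exists (edge_at i); rewrite ?mem_enum.
by rewrite chosen_pos pos_lt.
Qed.

Lemma number_proof e : rank chosen (pos e) < n.
Proof. by rewrite -rank_chosen_size ltn_rank ?chosen_pos // pos_lt. Qed.

(** The only numbering compatible with a canonical outercycle, which meets the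
    even darts in increasing order. *)
Definition number e : 'I_n := Ordinal (number_proof e).

Lemma number_inj : injective number.
Proof.
move=> e f /(congr1 val) /= ef; apply: pos_inj; apply/eqP.
have [lt|lt|//] := ltngtP (pos e) (pos f);
  by move: lt; rewrite -(ltn_rank _ (chosen_pos _)) ef ltnn.
Qed.

Lemma number_bij : bijective number.
Proof. by apply: inj_card_bij number_inj _; rewrite card_ord cardE. Qed.

Lemma number_inv : exists h, cancel number h /\ cancel h number.
Proof. by have [h nK hK] := number_bij; exists h. Qed.

Definition edge_no : 'I_n -> edge G := sval (cid number_inv).

Lemma numberK : cancel number edge_no.
Proof. by rewrite /edge_no; case: cid => h []. Qed.

Lemma edge_noK : cancel edge_no number.
Proof. by rewrite /edge_no; case: cid => h []. Qed.

(** The two darts of an edge stand for the start and the end of its forward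
    passage. *)
Definition time (x : 'I_n.*2) : nat := pos (edge_no (pair_of x)) + odd x.
Definition place x := vertex_at (time x).

Lemma val_pair (x : 'I_n.*2) : x./2 = rank chosen (pos (edge_no (pair_of x))).
Proof. by have := congr1 val (edge_noK (pair_of x)). Qed.

Lemma time_mono (x y : 'I_n.*2) : x <= y -> time x <= time y.
Proof.
move=> xy; rewrite /time; have := half_leq xy.
rewrite leq_eqVlt => /predU1P[e|].
  have -> : pair_of x = pair_of y by apply/val_inj.
  rewrite leq_add2l; lia.
rewrite !val_pair ltn_rank ?chosen_pos // => lt.
apply: leq_trans (leq_addr _ _); apply: leq_trans _ lt.
by rewrite -addn1 leq_add2l; case: odd.
Qed.

Lemma time_le x : time x <= size C.
Proof.
rewrite /time; apply: leq_trans _ (pos_lt (edge_no (pair_of x))).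
by rewrite -addn1 leq_add2l; case: odd.
Qed.

Definition fibers := preim_partition place [set: 'I_n.*2].

Lemma fibersP : partition fibers [set: 'I_n.*2].
Proof. exact: preim_partitionP. Qed.

Lemma fibers_eq x y :
  (place x == place y) = (pblock fibers x == pblock fibers y).
Proof.
have /and3P[/eqP cov tr _] := fibersP.
have E u v : (v \in pblock fibers u) = (place u == place v).
  rewrite pblock_equivalence_partition ?inE //.
  by move=> ? ? ? _ _ _; split=> //= /eqP->.
rewrite -E; apply/idP/eqP => [/(same_pblock tr) ->//|->].
by rewrite mem_pblock cov inE.
Qed.

(** Darts follow each other along the tour, so a crossing of two fibers would
    be an interleaving of visits. *)
Lemma fibers_noncrossing : noncrossing fibers.
Proof.
have /and3P[_ tr _] := fibersP.
apply/'forall_implyP => B1 B1f; apply/'forall_implyP => B2 B2f.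
apply/'forall_implyP => a aB; apply/'forall_implyP => b bB.
apply/'forall_implyP => c cB; apply/'forall_implyP => d dB.
apply/implyP => /and3P[ab bc cd].
rewrite -(def_pblock tr B1f aB) -(def_pblock tr B2f bB) -fibers_eq.
have ac : place a = place c.
  by apply/eqP; rewrite fibers_eq !(def_pblock tr B1f).
have bd : place b = place d.
  by apply/eqP; rewrite fibers_eq !(def_pblock tr B2f).
have := time_mono (ltnW ab); rewrite leq_eqVlt => /predU1P[e|tab].
  by rewrite /place e.
have := time_mono (ltnW bc); rewrite leq_eqVlt => /predU1P[e|tbc].
  by rewrite ac /place e.
have := time_mono (ltnW cd); rewrite leq_eqVlt => /predU1P[e|tcd].
  by rewrite ac bd /place e.
by rewrite /place (tour_uncrossed cactusG outerC tab tbc tcd (time_le d)).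
Qed.

Lemma fibers_NC : partition fibers [set: 'I_n.*2] && noncrossing fibers.
Proof. by rewrite fibersP fibers_noncrossing. Qed.

Definition realisation : NC n.*2 := exist _ fibers fibers_NC.

Lemma tour_dart_proof i :
  (number (edge_at i)).*2 + ~~ chosen i < n.*2.
Proof. have := ltn_ord (number (edge_at i)); case: chosen => /=; lia. Qed.

(** A backward passage starts from the end of the forward one. *)
Definition tour_dart i : 'I_n.*2 := Ordinal (tour_dart_proof i).

Lemma odd_tour_dart i : odd (tour_dart i) = ~~ chosen i.
Proof. by rewrite /= oddD odd_double; case: chosen. Qed.

Lemma pair_tour_dart i : pair_of (tour_dart i) = number (edge_at i).
Proof. by apply/val_inj => /=; case: chosen => /=; lia. Qed.

Lemma val_tau_tour_dart i :
  tau (tour_dart i) = (number (edge_at i)).*2 + chosen i :> nat.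
Proof. by rewrite val_tau odd_tour_dart /=; case: chosen => /=; lia. Qed.

Lemma pair_tau_tour_dart i : pair_of (tau (tour_dart i)) = number (edge_at i).
Proof.
by apply/val_inj; rewrite -[LHS]/(tau _)./2 val_tau_tour_dart;
  case: chosen => /=; lia.
Qed.

Lemma place_tour_dart i : i < size C -> place (tour_dart i) = vertex_at i.
Proof.
move=> iC; rewrite /place /time pair_tour_dart numberK odd_tour_dart.
have [/eqP->|/eqP/eqP ni] := boolP (chosen i); first by rewrite addn0.
rewrite addn1; apply: esym; apply: (flexible_opposite outerC) => //.
by rewrite eq_sym.
Qed.

Lemma place_tau_tour_dart i : i < size C ->
  place (tau (tour_dart i)) = vertex_at i.+1.
Proof.
move=> iC; rewrite /place /time pair_tau_tour_dart numberK val_tau_tour_dart.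
rewrite oddD odd_double.
have [/eqP->|/eqP/eqP ni] := boolP (chosen i); first by rewrite addn1.
by rewrite addn0; apply: (flexible_opposite outerC) => //; rewrite edge_pos.
Qed.

(** Next to a backward passage [j], the darts between the cut at time [j] and
    the end of the forward passage of the same edge lie exactly beyond that
    edge; in particular they form a union of blocks. *)
Lemma alike_backward j : j < size C -> ~~ chosen j ->
  alike realisation (rank chosen j).*2 (number (edge_at j)).*2.+1.
Proof.
move=> jC nj z w zw; set p := pos (edge_at j).
have [||X XE] := flexible_tour outerC jC (pos_lt (edge_at j)).
- by rewrite edge_pos.
- by rewrite eq_sym.
have cut_j (x : 'I_n.*2) : (x < (rank chosen j).*2) = (time x <= j).
  rewrite -ltn_half_double val_pair ltn_rank ?chosen_pos // /time.
  set q := pos (edge_no (pair_of x)); have : q != j.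
    by apply: contraNneq nj => <-; exact: chosen_pos.
  by case: odd => /=; lia.
have cut_p (x : 'I_n.*2) : (x < (number (edge_at j)).*2.+1) = (time x <= p).
  rewrite ltnS /= -/p.
  have := ltn_rank p (chosen_pos (edge_no (pair_of x))).
  have := ltn_rank (pos (edge_no (pair_of x))) (chosen_pos (edge_at j)).
  rewrite -val_pair /time -/p; have := odd_double_half x.
  move: (rank chosen p) (pos (edge_no _)) x./2 => r q k.
  by case: odd => /=; lia.
have pzw : place z = place w by apply/eqP; rewrite fibers_eq; apply/eqP.
have side x : (time x <= j) (+) (time x <= p) = X v0 (+) X (place x).
  rewrite /place XE ?time_le // -/p !ltnNge.
  by case: (X v0) (time x <= j) (time x <= p) => [] [] [].
by rewrite !cut_j !cut_p !side pzw.
Qed.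

Lemma alike_departure j : j < size C ->
  alike realisation (rank chosen j).*2 (tour_dart j).
Proof.
move=> jC; have [cj|nj] := boolP (chosen j); last first.
  by have := alike_backward jC nj; rewrite /= nj addn1.
by rewrite /= cj addn0 (eqP cj); exact: alike_refl.
Qed.

Lemma alike_arrival i : i < size C ->
  alike realisation (tau (tour_dart i)).+1 (rank chosen i.+1).*2.
Proof.
move=> iC; rewrite val_tau_tour_dart rankS.
have [ci|ni] := boolP (chosen i).
  by rewrite /= (eqP ci) !addn1 doubleS; exact: alike_refl.
by rewrite !addn0; apply/alike_sym/alike_backward.
Qed.

Hypotheses (n_gt0 : 0 < n) (pos0 : pos e0 = 0).

Lemma tour_dart0 : tour_dart 0 = Ordinal (first_proof n_gt0).
Proof. by apply/val_inj; rewrite /= /chosen /= pos0. Qed.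

Definition next_time i := if i.+1 == size C then 0 else i.+1.

(** The cut at time [i.+1] is alike both to the cut after the arrival of the
    passage [i] and to the cut before the departure of the next passage. *)
Lemma Sperm_tour_dart i : i < size C ->
  Sperm realisation (tau (tour_dart i)) = tour_dart (next_time i).
Proof.
move=> iC; apply: Sperm_unique.
  apply/eqP; rewrite -fibers_eq place_tau_tour_dart //; apply/eqP.
  rewrite /next_time; case: eqP => [->|/eqP niC].
    by rewrite place_tour_dart // vertex_at_size.
  by rewrite place_tour_dart // ltn_neqAle niC.
apply: alike_trans (alike_arrival iC) _; rewrite /next_time.
case: eqP => [->|/eqP niC].
  by rewrite rank_chosen_size tour_dart0; apply: alike_ends.
by apply: alike_departure; rewrite ltn_neqAle niC.
Qed.

Lemma tour_dart_inj i j : i < size C -> j < size C ->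
  tour_dart i = tour_dart j -> i = j.
Proof.
move=> iC jC ij; have eij : edge_at i = edge_at j.
  by apply: number_inj; rewrite -!pair_tour_dart ij.
have := odd_tour_dart j; rewrite -ij odd_tour_dart => /negb_inj.
have [/eqP <-|ni] := boolP (chosen i) => cj.
  by rewrite eij; apply/eqP; rewrite -[_ == _]/(chosen j) -cj.
by apply: (edge_at_thrice outerC (pos_lt (edge_at i)));
  rewrite ?edge_pos // eij -[_ == _]/(chosen j) -cj.
Qed.

Lemma dart_realisation i : i < size C -> dart n_gt0 realisation i = tour_dart i.
Proof.
elim: i => [|i IH] iC; first by rewrite tour_dart0.
have iC' := ltnW iC; rewrite dartS (IH iC') (Sperm_tour_dart iC').
by rewrite /next_time (ltn_eqF iC).
Qed.

Lemma period_realisation : period n_gt0 realisation = size C.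
Proof.
have dart_size : dart n_gt0 realisation (size C) = dart n_gt0 realisation 0.
  rewrite [size C]/= dartS dart_realisation // Sperm_tour_dart //.
  by rewrite /next_time eqxx tour_dart0.
have [lt|lt|//] := ltngtP (period n_gt0 realisation) (size C).
  have := dart_period n_gt0 realisation; rewrite !dart_realisation //.
  move=> E; have p0 := @tour_dart_inj _ 0 lt isT E.
  have := order_gt0 (Sperm realisation \o @tau n)
                    (Ordinal (first_proof n_gt0)).
  by rewrite -/(period _ _) p0.
have := dart_neq0 (pi := realisation) (isT : 0 < size C) lt.
by rewrite dart_size.
Qed.

Lemma orbit_realisation :
  orbit (Sperm realisation \o @tau n) (Ordinal (first_proof n_gt0))
    = [seq tour_dart i | i <- iota 0 (size C)].
Proof.
apply: (@eq_from_nth _ (tour_dart 0)).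
  by rewrite size_orbit size_map size_iota; exact: period_realisation.
move=> i; rewrite size_orbit => ip; rewrite nth_orbit //.
move: ip; rewrite -/(period _ _) period_realisation => iC.
by rewrite (nth_map 0) ?size_iota // nth_iota // dart_realisation.
Qed.

Lemma realisation_labelling : labelling n_gt0 realisation C place edge_no.
Proof.
split.
- by exists number; [exact: edge_noK|exact: numberK].
- move=> v; have [i iC] := tour_visits cactusG outerC v.
  by case=> ->; [exists (tour_dart i)|exists (tau (tour_dart i))];
    rewrite ?place_tour_dart ?place_tau_tour_dart.
- exact: fibers_eq.
- move=> k; have := tour_step outerC (pos_lt (edge_no k)); rewrite edge_pos.
  move=> /eqP->; congr [set _; _]; rewrite /place /time.
    rewrite /= odd_double addn0; congr (vertex_at (pos (edge_no _))).
    by apply/val_inj; rewrite /= doubleK.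
  rewrite /= odd_double addn1; congr (vertex_at (pos (edge_no _)).+1).
  by apply/val_inj; rewrite /= uphalf_double.
- rewrite orbit_realisation -map_comp.
  apply: (@eq_from_nth _ (v0, e0)); first by rewrite size_map size_iota.
  move=> i iC; rewrite (nth_map 0) ?size_iota // nth_iota // add0n /=.
  by rewrite nth_tour // place_tour_dart // pair_tour_dart numberK.
Qed.

Lemma realisation_connected : connected (pgraph realisation).
Proof. exact: labelling_connected realisation_labelling cactusG.1. Qed.

Lemma forward_realisation i : i < size C ->
  forward n_gt0 realisation i = (pos (edge_at i) == i).
Proof.
by move=> iC; rewrite /forward dart_realisation // odd_tour_dart negbK.
Qed.

End Realisation.

(** * Counting *)

Section Counting.
Variables (n : nat) (n_gt0 : 0 < n).
Variables (G : mgraph) (v0 : vertex G) (e0 : edge G) (C' : walk G).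
Let C := (v0, e0) :: C'.
Hypothesis ocg : OCG n C.
Local Notation vertex_at := (vertex_at v0 e0 C').
Local Notation edge_at := (edge_at v0 e0 C').

Section OnePartition.
Variables (pi : NC n.*2) (l : 'I_n.*2 -> vertex G) (g : 'I_n -> edge G).
Hypothesis lab : labelling n_gt0 pi C l g.

Lemma labelling_period : period n_gt0 pi = size C.
Proof. by case: lab => _ _ _ _ ->; rewrite size_map size_orbit. Qed.

Lemma labelling_dart i : i < size C ->
  l (dart n_gt0 pi i) = vertex_at i /\
  g (pair_of (dart n_gt0 pi i)) = edge_at i.
Proof.
move=> iC; have ip : i < period n_gt0 pi by rewrite labelling_period.
have := nth_tour iC; case: lab => _ _ _ _; rewrite -/C => {1}->.
rewrite (nth_map (dart n_gt0 pi 0)) ?size_orbit // nth_orbit //.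
by case=> -> ->.
Qed.

Lemma labelling_dart_le i : i <= size C -> l (dart n_gt0 pi i) = vertex_at i.
Proof.
rewrite leq_eqVlt => /predU1P[->|/labelling_dart[]//].
rewrite -{1}labelling_period dart_period vertex_at_size.
by have [] := labelling_dart (isT : 0 < size C).
Qed.

Lemma forward_inj i j : i < size C -> j < size C ->
  forward n_gt0 pi i -> forward n_gt0 pi j -> edge_at i = edge_at j -> i = j.
Proof.
move=> iC jC fi fj; have [bg _ _ _ _] := lab.
have [[_ <-] [_ <-]] := (labelling_dart iC, labelling_dart jC).
move=> /(bij_inj bg)/(congr1 val) /= ij.
apply: (@dart_inj _ n_gt0 pi); rewrite ?labelling_period //.
apply/val_inj => /=.
rewrite -[LHS]odd_double_half -[RHS]odd_double_half ij.
by rewrite (negbTE fi) (negbTE fj).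
Qed.

Lemma forward_surj e : connected (pgraph pi) ->
  exists i : 'I_(size C), forward n_gt0 pi i /\ edge_at i = e.
Proof.
move=> conn; have [[h _ hK] _ _ _ _] := lab.
have [i [ip fi di]] := dart_surj n_gt0 conn (ltn_ord (h e)).
rewrite labelling_period in ip; exists (Ordinal ip); split=> //=.
have [_ <-] := labelling_dart ip; rewrite -[RHS]hK; congr g.
by apply/val_inj; rewrite /= di doubleK.
Qed.

End OnePartition.

(** The forward passages determine the darts visited by them, because even
    darts are visited in increasing order; the walk then says to which vertex
    either dart of each edge belongs. *)
Lemma labelling_determined pi pi' l l' g g' :
  connected (pgraph pi) -> connected (pgraph pi') ->
  labelling n_gt0 pi C l g -> labelling n_gt0 pi' C l' g' ->
  (forall i, i < size C -> forward n_gt0 pi i = forward n_gt0 pi' i) ->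
  l =1 l'.
Proof.
move=> conn conn' lab lab' ff x.
have [i [ip fi di]] := dart_surj n_gt0 conn (ltn_ord (pair_of x)).
have iC : i < size C by rewrite -(labelling_period lab).
have fi' : forward n_gt0 pi' i by rewrite -ff.
have dd : dart n_gt0 pi i = dart n_gt0 pi' i.
  apply/val_inj; rewrite /= (forward_dart conn ip fi).
  rewrite (forward_dart conn' _ fi') ?(labelling_period lab') //.
  congr (_.*2); apply: eq_in_count => j; rewrite mem_iota add0n => ji.
  exact: ff (ltn_trans ji iC).
have [[_ _ l_eq _ _] [_ _ l_eq' _ _]] := (lab, lab').
have [ox|ex] := boolP (odd x); last first.
  have -> : x = dart n_gt0 pi i.
    by apply/val_inj; rewrite /= di -[LHS]odd_double_half (negbTE ex).
  by rewrite {2}dd (labelling_dart lab iC).1 (labelling_dart lab' iC).1.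
have -> : x = tau (dart n_gt0 pi i).
  apply/val_inj; rewrite /= di odd_double.
  by rewrite -[LHS]odd_double_half ox.
have -> : l (tau (dart n_gt0 pi i)) = l (dart n_gt0 pi i.+1).
  by apply/eqP; rewrite l_eq dartS blk_Sperm.
rewrite dd; have -> : l' (tau (dart n_gt0 pi' i)) = l' (dart n_gt0 pi' i.+1).
  by apply/eqP; rewrite l_eq' dartS blk_Sperm.
by rewrite (labelling_dart_le lab) // (labelling_dart_le lab').
Qed.

Lemma NC_eq (pi pi' : NC n.*2) :
  (forall x y, (pblock (val pi) x == pblock (val pi) y)
             = (pblock (val pi') x == pblock (val pi') y)) -> pi = pi'.
Proof.
move=> eqb.
have blkE (p : NC n.*2) x y :
    (y \in pblock (val p) x) = (pblock (val p) x == pblock (val p) y).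
  by apply/idP/eqP => [/blk_eq ->|->] //; exact: mem_blk.
have E x : pblock (val pi) x = pblock (val pi') x.
  by apply/setP => y; rewrite !blkE eqb.
have inE' (p : NC n.*2) B : (B \in val p) = [exists x, B == pblock (val p) x].
  apply/idP/existsP => [Bp|[x /eqP->]]; last exact: pblock_in.
  have [x /(congr1 val) /= ->] := block_ofP (exist _ B Bp : blockT p).
  by exists x.
by apply/val_inj/setP => B; rewrite !inE'; apply: eq_existsb => x; rewrite E.
Qed.

Definition target : {set NC n.*2} :=
  [set pi | `[< connected (pgraph pi) /\
                oriented_iso (canonical_outercycle pi n_gt0) C >]].

Definition forward_set (pi : NC n.*2) : {set 'I_(size C)} :=
  [set i : 'I_(size C) | forward n_gt0 pi i].

Lemma targetP pi :
  pi \in target <->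
  connected (pgraph pi) /\ exists l g, labelling n_gt0 pi C l g.
Proof.
rewrite inE; split=> [/asboolP[c /oriented_isoP]//|[c /oriented_isoP i]].
exact/asboolP.
Qed.

Lemma forward_set_inj : {in target &, injective forward_set}.
Proof.
move=> pi pi' /targetP[conn [l [g lab]]] /targetP[conn' [l' [g' lab']]] ff.
have ll : l =1 l'.
  apply: (labelling_determined conn conn' lab lab') => i iC.
  by move/setP/(_ (Ordinal iC)): ff; rewrite !inE.
have [[_ _ l_eq _ _] [_ _ l_eq' _ _]] := (lab, lab').
by apply: NC_eq => x y; rewrite -l_eq -l_eq' !ll.
Qed.

(** A canonical outercycle starts at an even dart, which forces the passage at
    time 0 to be forward. *)
Definition passages (e : edge G) : pred 'I_(size C) :=
  fun i => (edge_at i == e) && ((e == e0) ==> (i == 0 :> nat)).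

Definition chosen_set (c : {ffun edge G -> 'I_(size C)}) : {set 'I_(size C)} :=
  [set i : 'I_(size C) | c (edge_at i) == i].

Lemma passagesP c : c \in family passages ->
  (forall e : edge G, edge_at (c e) = e) /\ c e0 = 0 :> nat.
Proof.
move=> /familyP cP; split=> [e|]; have := cP; last first.
  by move=> /(_ e0); rewrite unfold_in eqxx => /andP[_ /eqP].
by move=> /(_ e) /andP[/eqP].
Qed.

Lemma chosen_set_inj : {in family passages &, injective chosen_set}.
Proof.
move=> c c' /passagesP[cE _] /passagesP[_ _] cc; apply/ffunP => e.
move/setP/(_ (c e)): cc; rewrite !inE. rewrite (cE e) eqxx => /esym/eqP->.
by [].
Qed.

(** Both sides describe the possible sets of forward passages. *)
Lemma forward_sets : forward_set @: target = chosen_set @: family passages.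
Proof.
apply/setP => J; apply/imsetP/imsetP.
  move=> [pi /targetP[conn [l [g lab]]] ->].
  have [c cP] := fin_all_exists (fun e => forward_surj lab e conn).
  have cE e : edge_at (c e) = e by case: (cP e).
  have cf e : forward n_gt0 pi (c e) by case: (cP e).
  have cu e (i : 'I_(size C)) : forward n_gt0 pi i -> edge_at i = e -> c e = i.
    move=> fi ie; apply/val_inj.
    apply: (forward_inj lab (ltn_ord _) (ltn_ord _) (cf e) fi).
    by rewrite cE ie.
  exists (finfun c).
    apply/familyP => e; rewrite unfold_in ffunE cE eqxx /=.
    by apply/implyP => /eqP->; rewrite (cu e0 ord0).
  apply/setP => i; rewrite !inE ffunE; apply/idP/eqP => [fi|<-//].
  exact: cu.
move=> [c /passagesP[cE c0] ->].
have clt e : c e < size C by [].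
exists (realisation ocg clt cE).
  apply/targetP; split; first exact: realisation_connected.
  do 2!eexists; exact: realisation_labelling.
apply/setP => i; rewrite !inE forward_realisation //.
Qed.

Lemma card_passages e : #|passages e| = 2 ^ (`[< flexible e >] && (e0 != e)).
Proof.
have [_ outerC _] := ocg; have [_ rig flex] := outerC.
have [<-|ne] := eqVneq e0 e.
  rewrite andbF expn0 -(card1 (ord0 : 'I_(size C))); apply: eq_card => i.
  rewrite !inE unfold_in eqxx /=; apply/andP/eqP => [[_ /eqP i0]|->//].
  exact/val_inj.
have -> : #|passages e| = count_mem e (unzip2 C).
  rewrite count_tour cardsE; apply: eq_card => i.
  by rewrite !unfold_in [e == e0]eq_sym (negbTE ne) andbT.
rewrite andbT; case: asboolP => [/flex//|]; by move/contrapT/rig.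
Qed.

Lemma card_choices :
  #|(family passages : pred {ffun edge G -> 'I_(size C)})| = 2 ^ flexcount C.
Proof.
rewrite card_family foldrE big_map big_enum /=.
under eq_bigr do rewrite card_passages.
rewrite -expn_sum; congr (2 ^ _); rewrite /flexcount -sum1_card big_mkcond.
rewrite [RHS]big_mkcond /=; apply: eq_bigr => e _; rewrite !inE.
by rewrite -[_ != Some e]/(e0 != e); case: (_ && _).
Qed.

Lemma card_target : #|target| = 2 ^ flexcount C.
Proof.
rewrite -card_choices -(card_in_imset forward_set_inj) forward_sets.
exact: card_in_imset chosen_set_inj.
Qed.

End Counting.

Theorem proposition1p13 (n : nat) (n_gt0 : 0 < n) (G : mgraph) (C : walk G) :
  OCG n C ->
  #|[set pi : NC n.*2 |
      `[< connected (pgraph pi) /\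
          oriented_iso (canonical_outercycle pi n_gt0) C >]]|
    = 2 ^ flexcount C.
Proof.
case: C => [|[v0 e0] C'] ocg; last exact: card_target ocg.
have [_ [_ rig flex] cardE] := ocg.
(* The empty walk passes through no edge, but there is at least one. *)
have e : edge G.
  by apply: (enum_val (Ordinal (_ : 0 < #|edge G|))); rewrite cardE.
by have [/rig|/flex] := EM (rigid e).
Qed.
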